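(* Let $n\ge1$, $k\in\mathbb{N}_0$, $\mu=k\omega_1$, $N=\binom{n+k}{k}$. Let $a\in A_{\mathrm{reg}}$ and consider $g_a\in\mathrm{GL}_{n+1}(\mathbb{C})$. Let $D\in\mathrm{End}(\mathbb{C}^N)$ be the diagonal matrix with entries $D_{\sigma,\sigma}=\|e_\sigma\|=\binom{k}{\sigma}^{-1/2}$. Then $$\Phi^\mu_0(a)\cdot C(\Gamma)=D\cdot[g_a]^{\mathcal{E}_n}_{\mathcal{E}_n}\cdot D\in\mathrm{End}(\mathbb{C}^N).$$
   Context: Groups. $G=\mathrm{SL}(n+1,\mathbb{C})\times\mathrm{SL}(n+1,\mathbb{C})$, $H=\mathrm{diag}\,\mathrm{SL}(n+1,\mathbb{C})$, with compact forms $U=\mathrm{SU}(n+1)\times\mathrm{SU}(n+1)$ and $K=\mathrm{diag}\,\mathrm{SU}(n+1)$; $A=\{(t,t^{-1})\mid t\in T\}$, $T$ the diagonal torus of $\mathrm{SL}(n+1,\mathbb C)$; $A_{\mathrm{reg}}$ is the set of $(t,t^{-1})\in A$ with $t_i^2\ne t_j^2$ for $i\ne j$. Highest weights of $G$ are with respect to $B\times B$ ($B$ upper triangular); $\omega_i$ are the fundamental weights of $\mathrm{SL}(n+1,\mathbb C)$, $\omega_0=\omega_{n+1}=0$. Put $\lambda_i=(\omega_i,\omega_{n+2-i})$, $i=1,\dots,n+1$. $V=\mathbb{C}^{n+1}$ with standard orthonormal basis $e_1,\dots,e_{n+1}$. Symmetric powers. Compositions of $k$ are $\tau\in\mathbb{N}_0^{n+1}$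 with $\sum\tau_i=k$ (there are $N$); $\binom{k}{\tau}=k!/(\tau_1!\cdots\tau_{n+1}!)$. $S^k(V)$ has basis $\mathcal{E}$ of monomials $e_\tau=e^\tau=e_1^{\tau_1}\cdots e_{n+1}^{\tau_{n+1}}$ and carries the $K$-invariant inner product for which they are orthogonal with $\|e_\tau\|^2=\binom{k}{\tau}^{-1}$. $\mathcal{E}_n=(\binom{k}{\sigma}^{1/2}e_\sigma)_\sigma$ is the normalized basis. $S^k(V)$ is the irreducible $H$-module $V^H_\mu$. $N\times N$ matrices are indexed by compositions. Spherical functions. If an irreducible $G$-module $V^G_\lambda$ contains $S^k(V)$ on restriction to $H$ (it does so at most once), $\Phi^\mu_\lambda(g)=p\circ\pi^G_\lambda(g)\circ j\in\mathrm{End}(S^k(V))$, with $j:S^k(V)\to V^G_\lambda$ an isometric $H$-equivariant embedding ($V^G_\lambda$ with a $U$-invariant inner product) and $p=j^*$. For $\tau$ a composition of $k$ let $\lambda(0,\tau)=\sum_i\tau_i\lambda_i$; $V^G_{\lambda(0,\tau)}$ contains $S^k(V)$. For $a\in A$, $\Phi^\mu_\lambda(a)$ is diagonal in the basis $\mathcal{E}$, and $\Phi^\mu_0(a)_{\sigma,\tau}$ is the scalar by which $\Phi^\mu_{\lambda(0,\tau)}(a)$ acts on $e_\sigma$. The matrix $g_a$. $g_a:=\Phi^{\omega_1}_0(a)\in\mathrm{End}(\mathbb{C}^{n+1})$, i.e. $(g_a)_{ij}$ is the scalar by which $\Phi^{\omega_1}_{\lambda_j}(a)$ acts on $e_i$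 (the case $k=1$). $[g_a]^{\mathcal{E}_n}_{\mathcal{E}_n}$ is the matrix in the basis $\mathcal{E}_n$ of the natural (multiplicative) action of $g_a$ on $S^k(V)$. The embeddings $\Gamma$. For compositions $\tau,\rho$ of $k$, $M(\tau,\rho)$ is the set of $(s^1,\dots,s^{n+1})\in(\mathbb{N}_0^{n+1})^{n+1}$ with $\sum_q s^p_q=\tau_p$ for all $p$ and $\sum_p s^p_q=\rho_q$ for all $q$. Let $$i_\tau:S^k(V)\to\bigotimes_{i=1}^{n+1}S^{\tau_i}(V),\quad e_\rho\mapsto\binom{k}{\rho}^{-1}\sum_{(s)\in M(\tau,\rho)}\binom{\tau_1}{s^1}e^{s^1}\otimes\cdots\otimes\binom{\tau_{n+1}}{s^{n+1}}e^{s^{n+1}},$$ let $as_m:S^m(V)\to V^{\otimes m}$ send $\binom{m}{s}e^s$ to the sum of all $\binom{m}{s}$ distinct tensors $e_{i_1}\otimes\cdots\otimes e_{i_m}$ containing each $e_j$ exactly $s_j$ times, and let $\beta_i:V\to V^G_{\lambda_i}$ be an isometric $H$-equivariant embedding. Put $T(\tau)=\bigotimes_{i=1}^{n+1}(V^G_{\lambda_i})^{\otimes\tau_i}$ and $\gamma_\tau=\bigl(\bigotimes_{i}\beta_i^{\otimes\tau_i}\circ as_{\tau_i}\bigr)\circ i_\tau:S^k(V)\to T(\tau)$, an $H$-equivariant isometric embedding; $\Gamma=(\gamma_\tau)_\tau$. The matrix $C(\Gamma)$. With $\pi^G_{T(\tau)}$ the $G$-representation on $T(\tau)$, $\gamma_\tau^*\circ\pi^G_{T(\tau)}(a)\circ\gamma_\tau=\sum_{\lambda'\le\lambda(0,\tau)}c_{\lambda',\gamma_\tau}\Phi^\mu_{\lambda'}(a)$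 for unique constants $c_{\lambda',\gamma_\tau}$ (non-negative with sum one, and nonzero only for $\lambda'$ of the form $\lambda(0,\sigma)$); $C(\Gamma)_{\sigma,\tau}=c_{\lambda(0,\sigma),\gamma_\tau}$. *)

(* Defs.v *)
From HB Require Import structures.
From mathcomp Require Import all_boot all_order all_algebra.
From mathcomp Require Import complex mpoly.
From mathcomp Require Import reals.

Set Implicit Arguments.
Unset Strict Implicit.
Unset Printing Implicit Defensive.

Import Order.TTheory GRing.Theory Num.Theory.

Local Open Scope ring_scope.
Local Open Scope complex_scope.
Local Open Scope sesquilinear_scope.

Definition Gelt (R : realType) (n : nat) : Type :=
  ('M[R[i]]_n.+1 * 'M[R[i]]_n.+1)%type.

Definition Gmul (R : realType) n (g h : Gelt R n) : Gelt R n :=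
  (g.1 *m h.1, g.2 *m h.2).

Definition Gone (R : realType) n : Gelt R n := (1%:M, 1%:M).

Definition inSL (R : realType) n (h : 'M[R[i]]_n.+1) : Prop := \det h = 1.

Definition inSU (R : realType) n (h : 'M[R[i]]_n.+1) : Prop :=
  inSL h /\ h^t* *m h = 1%:M.

Definition inG (R : realType) n (g : Gelt R n) : Prop := inSL g.1 /\ inSL g.2.

Definition inU (R : realType) n (g : Gelt R n) : Prop := inSU g.1 /\ inSU g.2.

Definition upper_triangular (R : realType) n (b : 'M[R[i]]_n.+1) : Prop :=
  forall i j : 'I_n.+1, (j < i)%N -> b i j = 0.

Definition inBB (R : realType) n (b : Gelt R n) : Prop :=
  [/\ inG b, upper_triangular b.1 & upper_triangular b.2].

(** [torus_elt t] is [(t, t^-1)], [t] being given by its diagonal. *)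
Definition torus_elt (R : realType) n (t : 'rV[R[i]]_n.+1) : Gelt R n :=
  (diag_mx t, invmx (diag_mx t)).

Definition inA (R : realType) n (a : Gelt R n) : Prop :=
  exists t : 'rV[R[i]]_n.+1, \prod_i t 0 i = 1 /\ a = torus_elt t.

Definition inAreg (R : realType) n (a : Gelt R n) : Prop :=
  exists t : 'rV[R[i]]_n.+1,
    [/\ \prod_i t 0 i = 1, a = torus_elt t &
        forall i j, i != j -> t 0 i ^+ 2 != t 0 j ^+ 2].

(** A weight of SL(n+1) is given by its coordinates in the basis of
    fundamental weights: entry [i : 'I_n] is the coefficient of
    omega_(i+1). *)
Definition weight (n : nat) : Type := {ffun 'I_n -> int}.

(** [omega n 0 = omega n n.+1 = 0]. *)
Definition omega (n i : nat) : {ffun 'I_n -> int} :=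
  [ffun j : 'I_n => ((j.+1 == i)%N : nat)%:Z].

Definition simple_root (n : nat) (j : 'I_n) : {ffun 'I_n -> int} :=
  omega n j.+1 *+ 2 - omega n j - omega n j.+2.

(** Value on the diagonal of [t], where omega_i(t) = t_1 ... t_i. *)
Definition wchar (R : realType) n (l : weight n) (t : 'M[R[i]]_n.+1) : R[i] :=
  \prod_(i < n) (\prod_(j < n.+1 | (j <= i)%N) t j j) ^ (l i).

Definition Gweight (n : nat) : Type :=
  ({ffun 'I_n -> int} * {ffun 'I_n -> int})%type.

Definition wle n (l' l : {ffun 'I_n -> int}) : Prop :=
  exists m : 'I_n -> nat, l - l' = \sum_j simple_root j *+ m j.

Definition Gwle n (l' l : Gweight n) : Prop :=
  wle l'.1 l.1 /\ wle l'.2 l.2.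

(** (omega_p, omega_(n+2-p)) with p = i + 1. *)
Definition lam (n : nat) (i : 'I_n.+1) : {ffun 'I_n -> int} * {ffun 'I_n -> int} :=
  (omega n i.+1, omega n (n.+1 - i)).

(** Coordinates are columns, operators are matrices acting on the left, and
    the inner product is given by its Gram matrix in the chosen basis, which
    need not be orthonormal: <x, y> = x^t* *m rform *m y.  The record holds
    the data only. *)
Record hrep (R : realType) (X : Type) := HRep {
  rdim : nat;
  ract : X -> 'M[R[i]]_rdim;
  rform : 'M[R[i]]_rdim
}.

Definition posdefmx (R : realType) d (Q : 'M[R[i]]_d) : Prop :=
  Q^t* = Q /\ forall v : 'cV[R[i]]_d, v != 0 -> 0 < (v^t* *m Q *m v) 0 0.

Definition adj (R : realType) (X Y : Type) (E : hrep R X) (F : hrep R Y)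
    (j : 'M[R[i]]_(rdim F, rdim E)) : 'M[R[i]]_(rdim E, rdim F) :=
  invmx (rform E) *m j^t* *m rform F.

(** Rational representations of G whose inner product is U-invariant. *)
Definition is_Gmodule (R : realType) n (W : hrep R (Gelt R n)) : Prop :=
  [/\ ract W (Gone R n) = 1%:M,
      forall g h, inG g -> inG h -> ract W (Gmul g h) = ract W g *m ract W h,
      forall i j, exists p : {mpoly R[i][n.+1 * n.+1 + n.+1 * n.+1]},
        forall g, inG g ->
          ract W g i j = p.@[fun x => row_mx (mxvec g.1) (mxvec g.2) 0 x],
      posdefmx (rform W)
    & forall u, inU u -> (ract W u)^t* *m rform W *m ract W u = rform W].

Definition Girreducible (R : realType) n (W : hrep R (Gelt R n)) : Prop :=
  (0 < rdim W)%N /\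
  forall S : {vspace 'cV[R[i]]_(rdim W)},
    (forall g v, inG g -> v \in S -> ract W g *m v \in S) ->
    S = 0%VS \/ S = fullv.

Definition has_highest_weight (R : realType) n (W : hrep R (Gelt R n))
    (l : Gweight n) : Prop :=
  exists2 v : 'cV[R[i]]_(rdim W), v != 0 &
    forall b, inBB b -> ract W b *m v = (wchar l.1 b.1 * wchar l.2 b.2) *: v.

(** [W] is a model of V^G_l with a U-invariant inner product. *)
Definition is_VG (R : realType) n (l : Gweight n) (W : hrep R (Gelt R n)) :
    Prop :=
  [/\ is_Gmodule W, Girreducible W & has_highest_weight W l].

Definition isoHembedding (R : realType) n (E : hrep R 'M[R[i]]_n.+1)
    (W : hrep R (Gelt R n)) (j : 'M[R[i]]_(rdim W, rdim E)) : Prop :=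
  j^t* *m rform W *m j = rform E /\
  forall h, inSL h -> j *m ract E h = ract W (h, h) *m j.

Definition containsH (R : realType) n (E : hrep R 'M[R[i]]_n.+1)
    (l : Gweight n) : Prop :=
  exists W : hrep R (Gelt R n), is_VG l W /\
    exists j : 'M[R[i]]_(rdim W, rdim E), isoHembedding j.

(** [F] is the spherical function g |-> j^* pi(g) j of type [E] attached to
    V^G_l.  It does not depend on the model of V^G_l, on the U-invariant inner
    product or on j, since V^G_l contains [E] at most once; [F] is required to
    be given by this formula for all such choices. *)
Definition is_spherical (R : realType) n (E : hrep R 'M[R[i]]_n.+1)
    (l : Gweight n) (F : Gelt R n -> 'M[R[i]]_(rdim E)) : Prop :=
  forall W : hrep R (Gelt R n), is_VG l W ->
  forall j : 'M[R[i]]_(rdim W, rdim E), isoHembedding j ->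
  forall g, inG g -> F g = adj j *m ract W g *m j.

(** The basis of the tensor product of the C^(p i), i in I. *)
Definition tidx (I : finType) (p : I -> nat) : finType :=
  {dffun forall i : I, 'I_(p i)}.

Definition tensmx (R : realType) (I : finType) (p q : I -> nat)
    (A : forall i, 'M[R[i]]_(p i, q i)) :
    'M[R[i]]_(#|tidx p|, #|tidx q|) :=
  \matrix_(r, c) \prod_i A i ((enum_val r : tidx p) i) ((enum_val c : tidx q) i).

Definition tensrep (R : realType) (X : Type) (I : finType)
    (W : I -> hrep R X) : hrep R X :=
  @HRep R X #|tidx (fun i => rdim (W i))|
    (fun x => tensmx (fun i => ract (W i) x))
    (tensmx (fun i => rform (W i))).

Definition compos (n k : nat) : finType :=
  {t : {ffun 'I_n.+1 -> 'I_k.+1} | (\sum_i (t i : nat) == k)%N}.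

Definition part n k (t : compos n k) (i : 'I_n.+1) : nat := val t i.

Definition sdim (n k : nat) : nat := #|compos n k|.

Lemma sdimE n k : sdim n k = 'C(n + k, k).
Proof.
have -> : 'C(n + k, k) = 'C(n + k, n) by rewrite -bin_sub ?leq_addl // addnK.
rewrite -card_ord_partitions /sdim card_sig -sum1_card -sum1_card.
rewrite (reindex (fun t : n.+1.-tuple 'I_k.+1 => [ffun i => tnth t i])) /=.
  by apply: eq_bigl => t; rewrite !inE big_tuple; under eq_bigr do rewrite ffunE.
exists (fun f : {ffun 'I_n.+1 -> 'I_k.+1} => [tuple f i | i < n.+1]) => [t|f] _.
  by apply: eq_from_tnth => i; rewrite tnth_mktuple ffunE.
by apply/ffunP => i; rewrite ffunE tnth_mktuple.
Qed.

Definition multi (R : realType) n k (t : compos n k) : R[i] :=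
  k`!%:R / \prod_i (part t i)`!%:R.

(** The matrix in the monomial basis of the multiplicative action of [g] on
    S^k: column [t] is the expansion of prod_i (g e_i)^(t_i). *)
Definition symmx (R : realType) n k (g : 'M[R[i]]_n.+1) :
    'M[R[i]]_(sdim n k) :=
  \matrix_(r, t)
    (\prod_i (\sum_j g j i *: 'X_j) ^+ part (enum_val t : compos n k) i
       : {mpoly R[i][n.+1]})
      @_[multinom part (enum_val r : compos n k) j | j < n.+1].

(** S^k(V) in the basis of monomials, with |e_t|^2 = multi(t)^-1. *)
Definition symrep (R : realType) n k : hrep R 'M[R[i]]_n.+1 :=
  @HRep R 'M[R[i]]_n.+1 (sdim n k) (@symmx R n k)
    (diag_mx (\row_t (multi R (enum_val t : compos n k))^-1)).

Definition stdrep (R : realType) n : hrep R 'M[R[i]]_n.+1 :=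
  @HRep R 'M[R[i]]_n.+1 n.+1 id 1%:M.

(** Column [t] is the element multi(t)^(1/2) e_t of the normalized basis. *)
Definition normalized_basis (R : realType) n k : 'M[R[i]]_(sdim n k) :=
  diag_mx (\row_t sqrtC (multi R (enum_val t : compos n k))).

(** [g] acting on S^k(V), written in the normalized basis. *)
Definition symmx_normalized (R : realType) n k (g : 'M[R[i]]_n.+1) :
    'M[R[i]]_(sdim n k) :=
  invmx (normalized_basis R n k) *m symmx k g *m normalized_basis R n k.

Definition Dmx (R : realType) n k : 'M[R[i]]_(sdim n k) :=
  diag_mx (\row_t sqrtC ((multi R (enum_val t : compos n k))^-1)).

Definition lam0 n k (t : compos n k) : {ffun 'I_n -> int} * {ffun 'I_n -> int} :=
  \sum_i lam i *+ part t i.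

(** In the next two definitions, the operators being diagonal in the basis
    (e_s), the scalar by which they act on e_s is a diagonal entry. *)
Definition Phi0 (R : realType) n k
    (Phi : Gweight n -> Gelt R n -> 'M[R[i]]_(sdim n k)) (a : Gelt R n) :
    'M[R[i]]_(sdim n k) :=
  \matrix_(s, t) Phi (lam0 (enum_val t : compos n k)) a s s.

Definition ga (R : realType) n
    (PhiV : Gweight n -> Gelt R n -> 'M[R[i]]_n.+1) (a : Gelt R n) :
    'M[R[i]]_n.+1 :=
  \matrix_(i, j) PhiV (lam j) a i i.

(** Rows are indexed by families s^p of compositions of t_p. *)
Definition i_mx (R : realType) n k (t : compos n k) :
    'M[R[i]]_(#|tidx (fun p => sdim n (part t p))|, sdim n k) :=
  \matrix_(f, r)
    let s p : compos n (part t p) :=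
      enum_val ((enum_val f : tidx (fun p => sdim n (part t p))) p) in
    let rho : compos n k := enum_val r in
    if [forall q, \sum_p part (s p) q == part rho q]%N
    then (multi R rho)^-1 * \prod_p multi R (s p) else 0.

(** multi(s) e^s is sent to the sum of the tensors e_(f 0) (x) ... (x) e_(f m.-1)
    in which each e_j occurs s_j times. *)
Definition as_mx (R : realType) n m :
    'M[R[i]]_(#|tidx (fun _ : 'I_m => n.+1)|, sdim n m) :=
  \matrix_(r, c)
    let f : tidx (fun _ : 'I_m => n.+1) := enum_val r in
    let s : compos n m := enum_val c in
    if [forall j : 'I_n.+1, #|[set x : 'I_m | f x == j]| == part s j]%N
    then (multi R s)^-1 else 0.

(** T(t), as the tensor product over p of the (V_(lambda_p))^(tensor t_p). *)
Definition Trep (R : realType) n k (W : 'I_n.+1 -> hrep R (Gelt R n))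
    (t : compos n k) : hrep R (Gelt R n) :=
  tensrep (fun p : 'I_n.+1 => tensrep (fun _ : 'I_(part t p) => W p)).

Definition gamma (R : realType) n k (W : 'I_n.+1 -> hrep R (Gelt R n))
    (beta : forall p, 'M[R[i]]_(rdim (W p), rdim (stdrep R n))) (t : compos n k) :
    'M[R[i]]_(rdim (Trep W t), rdim (symrep R n k)) :=
  tensmx (fun p : 'I_n.+1 =>
            tensmx (fun _ : 'I_(part t p) => beta p) *m as_mx R n (part t p))
  *m i_mx R t.

(** For each t, [s] enumerates the l <= lambda(0,t) for which V^G_l contains
    S^k(V), and [c] is the family of coefficients c_(l, gamma_t), extended by 0;
    they vanish when l is not of the form lambda(0,r). *)
Definition is_CGamma (R : realType) n k
    (Phi : Gweight n -> Gelt R n -> 'M[R[i]]_(rdim (symrep R n k)))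
    (W : 'I_n.+1 -> hrep R (Gelt R n))
    (beta : forall p, 'M[R[i]]_(rdim (W p), rdim (stdrep R n)))
    (Cm : 'M[R[i]]_(sdim n k)) : Prop :=
  forall t : compos n k,
  exists (s : seq ({ffun 'I_n -> int} * {ffun 'I_n -> int}))
         (c : Gweight n -> R[i]),
    [/\ uniq s
        /\ (forall l, l \in s <-> Gwle l (lam0 t) /\ containsH (symrep R n k) l),
        forall l, c l != 0 -> l \in s /\ exists r : compos n k, l = lam0 r,
        forall a, inA a ->
          adj (gamma beta t) *m ract (Trep W t) a *m gamma beta t
          = \sum_(l <- s) c l *: Phi l a
      & forall r : compos n k, Cm (enum_rank r) (enum_rank t) = c (lam0 r)].

(* Main.v *)
Require Import Defs.
From mathcomp Require Import all_boot all_order all_algebra.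
From mathcomp Require Import complex mpoly.
From mathcomp Require Import reals ring.

(** Since [lam0] is injective, the (s, t) entry of the left-hand side is the
    diagonal entry at [s] of the compression of pi_T(t)(a) along [gamma_t].
    This compression factors through tensor products: along [beta_p], pi(a)
    becomes the diagonal matrix whose entries are column [p] of [g_a]; along
    [as_m], its tensor power becomes the diagonal matrix of the coefficients of
    (sum_j (g_a)_jp X_j)^m, each divided by the square of a multinomial
    coefficient; and [i_t] cancels these squares while summing over [M(t, s)],
    which multiplies the polynomials for the various [p].  The outcome is
    multi(s)^-1 times the (s, t) entry of the action of [g_a] on S^k(V). *)

Set Implicit Arguments.
Unset Strict Implicit.
Unset Printing Implicit Defensive.

Import Order.TTheory GRing.Theory Num.Theory.

Local Open Scope ring_scope.
Local Open Scope complex_scope.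
Local Open Scope sesquilinear_scope.

(** * Distributivity over dependent families and tensor products of matrices *)

Lemma prod_sum_dffun (K : comNzRingType) (I : finType) (T : I -> finType)
    (F : forall i, T i -> K) :
  \prod_i \sum_(x : T i) F i x
  = \sum_(f : {dffun forall i, T i}) \prod_i F i (f i).
Proof.
(* Passing to tagged elements puts all the sums over one sigma type, where ordinary distributivity
   applies; the resulting families are then reindexed by dependent functions. *)
under eq_bigr => i _ do rewrite big_tag.
rewrite bigA_distr_big_dep.
pose P i : {ffun T i -> K} := finfun (F i).
transitivity (\sum_(g in family (tagged_with T)) \prod_i untag 0 (P i) (g i)).
  apply: eq_bigr => g _; apply: eq_bigr => i _.
  rewrite /untag; case: eqP => // e; by rewrite /P ffunE.
rewrite -(big_fprod _ _ P).
rewrite (reindex (@dffun_of_fprod _ T)); last exact/onW_bij/dffun_of_fprod_bij.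
by apply: eq_bigr => f _; apply: eq_bigr => i _; rewrite !ffunE.
Qed.

Lemma sum_enum_val (V : nmodType) (T : finType) (F : T -> V) :
  \sum_(i < #|T|) F (enum_val i) = \sum_x F x.
Proof. by rewrite [RHS](big_enum_val (A := T)). Qed.

Section TensorMatrices.

Variables (R : realType) (I : finType).

Lemma tensmx_mul (p q r : I -> nat) (A : forall i, 'M[R[i]]_(p i, q i))
    (B : forall i, 'M[R[i]]_(q i, r i)) :
  tensmx A *m tensmx B = tensmx (fun i => A i *m B i).
Proof.
apply/matrixP => x y; rewrite !mxE.
under [RHS]eq_bigr => i _ do rewrite mxE.
rewrite (prod_sum_dffun (T := fun i => 'I_(q i))) -[RHS]sum_enum_val.
by apply: eq_bigr => f _; rewrite !mxE -big_split.
Qed.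

Lemma tensmx_adjoint (p q : I -> nat) (A : forall i, 'M[R[i]]_(p i, q i)) :
  (tensmx A)^t* = tensmx (fun i => (A i)^t*).
Proof.
apply/matrixP => x y; rewrite !mxE rmorph_prod.
by apply: eq_bigr => i _; rewrite !mxE.
Qed.

Lemma tensmx_diag (p : I -> nat) (d : forall i, 'rV[R[i]]_(p i)) :
  tensmx (fun i => diag_mx (d i))
  = diag_mx (\row_f \prod_i d i 0 ((enum_val f : tidx p) i)).
Proof.
apply/matrixP => x y; rewrite !mxE.
have [<-|nxy] := eqVneq x y.
  by rewrite mulr1n; apply: eq_bigr => i _; rewrite mxE eqxx mulr1n.
have /existsP[i ni] : [exists i, (enum_val x : tidx p) i != (enum_val y : tidx p) i].
  apply: contraR nxy; rewrite negb_exists => /forallP h.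
  apply/eqP/enum_val_inj/ffunP => i; apply/eqP.
  by have := h i; rewrite negbK.
by rewrite mulr0n (bigD1 i) //= mxE (negbTE ni) mulr0n mul0r.
Qed.

Lemma eq_tensmx (p q : I -> nat) (A B : forall i, 'M[R[i]]_(p i, q i)) :
  (forall i, A i = B i) -> tensmx A = tensmx B.
Proof.
by move=> e; apply/matrixP => x y; rewrite !mxE; apply: eq_bigr => i _; rewrite e.
Qed.

Lemma tensmx_form (p q : I -> nat) (B : forall i, 'M[R[i]]_(p i, q i))
    (Q A : forall i, 'M[R[i]]_(p i)) :
  (tensmx B)^t* *m tensmx Q *m tensmx A *m tensmx B
  = tensmx (fun i => (B i)^t* *m Q i *m A i *m B i).
Proof. by rewrite tensmx_adjoint !tensmx_mul. Qed.

End TensorMatrices.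

Lemma adjointM (R : realType) m n p (A : 'M[R[i]]_(m, n)) (B : 'M_(n, p)) :
  (A *m B)^t* = B^t* *m A^t*.
Proof. by rewrite trmx_mul map_mxM. Qed.

(** For [c] the column [p] of [g], this is the vector [g e_p], seen in degree one of the symmetric
    algebra. *)
Definition linform (K : nzRingType) n (c : 'rV[K]_n.+1) : {mpoly K[n.+1]} :=
  \sum_j c 0 j *: 'X_j.

(* Kept generic in [K]: over [R[i]], unifying the two inferred ring structures
   on the polynomials does not terminate in reasonable time. *)
Lemma prod_linform (K : comNzRingType) n (g : 'M[K]_n.+1) (e : 'I_n.+1 -> nat) m :
  (\prod_i (\sum_j g j i *: 'X_j) ^+ e i : {mpoly K[n.+1]})@_m
  = (\prod_i linform (\row_j g j i) ^+ e i)@_m.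
Proof.
congr (_ @_ _); apply: eq_bigr => i _; congr (_ ^+ _).
by apply: eq_bigr => j _; rewrite mxE.
Qed.

(** * Compositions as exponents of homogeneous polynomials *)

Section Compositions.

Variables (R : realType) (n : nat).

Definition mono k (s : compos n k) : 'X_{1..n.+1} :=
  [multinom part s j | j < n.+1].

Lemma mono_inj k : injective (@mono k).
Proof.
move=> s t /mnmP e; apply/val_inj/ffunP => i; apply/val_inj.
by have := e i; rewrite !mnmE.
Qed.

Lemma sum_part k (s : compos n k) : (\sum_i part s i)%N = k.
Proof. exact/eqP/(valP s). Qed.

Lemma mdeg_mono k (s : compos n k) : mdeg (mono s) = k.
Proof. by rewrite mdegE; under eq_bigr do rewrite mnmE; exact: sum_part. Qed.

Lemma mono_surj (m : 'X_{1..n.+1}) : exists s : compos n (mdeg m), mono s = m.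
Proof.
have le i : (m i < (mdeg m).+1)%N by rewrite ltnS mdegE (bigD1 i) //= leq_addr.
pose f : {ffun 'I_n.+1 -> 'I_(mdeg m).+1} := [ffun i => Ordinal (le i)].
have hf : (\sum_i (f i : nat) == mdeg m)%N.
  by apply/eqP; rewrite [RHS]mdegE; apply: eq_bigr => i _; rewrite ffunE.
by exists (Sub f hf); apply/mnmP => i; rewrite mnmE /part /= ffunE.
Qed.

Lemma multi_neq0 k (s : compos n k) : multi R s != 0.
Proof.
rewrite /multi mulf_eq0 invr_eq0 pnatr_eq0 -leqn0 leqNgt fact_gt0 /=.
by apply/prodf_neq0 => i _; rewrite pnatr_eq0 -lt0n fact_gt0.
Qed.

Lemma multi_ge0 k (s : compos n k) : 0 <= multi R s.
Proof. by rewrite divr_ge0 ?ler0n // prodr_ge0. Qed.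

Lemma conj_multi k (s : compos n k) : Num.conj (multi R s) = multi R s.
Proof. exact: geC0_conj (multi_ge0 s). Qed.

Lemma linform_homog (c : 'rV[R[i]]_n.+1) : linform c \is 1.-homog.
Proof. by apply: rpred_sum => j _; rewrite rpredZ // dhomogX /= mdeg1. Qed.

(** Coefficients are compared: both sides vanish off degree [k], and an exponent of degree [k] is
    [mono s] for exactly one [s]. *)
Lemma homog_expansion k (P : {mpoly R[i][n.+1]}) : P \is k.-homog ->
  P = \sum_(s : compos n k) P@_(mono s) *: 'X_[mono s].
Proof.
move=> hP; apply/mpolyP => m; rewrite raddf_sum /=.
have [e|ne] := eqVneq (mdeg m) k; last first.
  rewrite (dhomog_nemf_coeff hP ne) big1 // => s _.
  rewrite mcoeffZ mcoeffX; case: eqP => [e|]; last by rewrite mulr0.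
  by rewrite -e mdeg_mono eqxx in ne.
(* Replacing [k] by [mdeg m] makes the composition given by [mono_surj] one of the summation
   indices. *)
case: k / e hP => hP; have [s es] := mono_surj m.
rewrite (bigD1 s) //= mcoeffZ mcoeffX es eqxx mulr1 big1 ?addr0 // => t nts.
rewrite mcoeffZ mcoeffX; case: eqP => [e|]; last by rewrite mulr0.
by move: nts; rewrite (mono_inj (etrans e (esym es))) eqxx.
Qed.

End Compositions.
Lemma symmxE (R : realType) n k (g : 'M[R[i]]_n.+1) s t :
  symmx k g s t
  = (\prod_i linform (\row_j g j i) ^+ part (enum_val t : compos n k) i)
      @_(mono (enum_val s : compos n k)).
Proof. by rewrite mxE; exact: prod_linform. Qed.

Lemma adjoint_diag_entry (R : realType) m n (A : 'M[R[i]]_(m, n)) (d : 'rV_m) x y :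
  (A^t* *m diag_mx d *m A) x y = \sum_f Num.conj (A f x) * d 0 f * A f y.
Proof. by rewrite mul_mx_diag mxE; apply: eq_bigr => f _; rewrite !mxE. Qed.

(** * Compression of diagonal operators along [as_mx] and [i_mx] *)

Section Embeddings.

Variables (R : realType) (n : nat).

(** The words [f] also index the rows of [as_mx], so [as_form] can compare sums term by term,
    without counting words. *)
Lemma linform_coef (c : 'rV[R[i]]_n.+1) m (x : 'X_{1..n.+1}) :
  (linform c ^+ m)@_x
  = \sum_(f : {dffun 'I_m -> 'I_n.+1})
      \prod_(j < m) c 0 (f j) * ((\sum_(j < m) U_(f j))%MM == x)%:R.
Proof.
rewrite -[m in LHS]card_ord -prodr_const (prod_sum_dffun (T := fun=> 'I_n.+1)).
rewrite raddf_sum /=; apply: eq_bigr => f _.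
by rewrite scaler_prod mprodXE mcoeffZ mcoeffX.
Qed.

Lemma content_mono m (f : {dffun 'I_m -> 'I_n.+1}) (s : compos n m) :
  [forall j : 'I_n.+1, #|[set x : 'I_m | f x == j]| == part s j]%N
  = ((\sum_(j < m) U_(f j))%MM == mono s).
Proof.
have E j : (\sum_(x < m) U_(f x))%MM j = #|[set x : 'I_m | f x == j]|.
  rewrite mnm_sumE -sum1dep_card [RHS]big_mkcond /=.
  by apply: eq_bigr => x _; rewrite mnm1E; case: eqP.
apply/forallP/eqP => [h|h j]; last by rewrite -E h mnmE.
by apply/mnmP => j; rewrite E mnmE; apply/eqP.
Qed.

Lemma as_mxE m f s :
  as_mx R n m f s
  = if (\sum_(j < m) U_((enum_val f : tidx (fun=> n.+1)) j))%MM
       == mono (enum_val s : compos n m)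
    then (multi R (enum_val s : compos n m))^-1 else 0.
Proof. by rewrite mxE -content_mono. Qed.

(** A word has only one content, so distinct columns of [as_mx] have disjoint supports. On the
    diagonal, the words of content [s] add up to a coefficient of the power, and the two entries of
    [as_mx] contribute the inverse square of [multi]. *)
Lemma as_form m (c : 'rV[R[i]]_n.+1) :
  (as_mx R n m)^t* *m tensmx (fun _ : 'I_m => diag_mx c) *m as_mx R n m
  = diag_mx (\row_s ((multi R (enum_val s : compos n m))^-2
                     * (linform c ^+ m)@_(mono (enum_val s : compos n m)))).
Proof.
rewrite tensmx_diag; apply/matrixP => s s'; rewrite adjoint_diag_entry !mxE.
have [<-|ns] := eqVneq s s'; last first.
  rewrite mulr0n big1 // => f _; rewrite !as_mxE.
  case: eqP => e1; last by rewrite rmorph0 !mul0r.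
  case: eqP => e2; last by rewrite mulr0.
  by case/eqP: ns; apply/enum_val_inj/mono_inj; rewrite -e1 -e2.
rewrite mulr1n linform_coef mulr_sumr -[RHS]sum_enum_val.
apply: eq_bigr => f _; rewrite !as_mxE mxE.
case: eqP => e; last by rewrite !mulr0.
rewrite fmorphV /= conj_multi mulr1 mulrAC; congr (_ * _).
by rewrite -invfM -expr2.
Qed.

Lemma family_mono k (t : compos n k) (s : forall p, compos n (part t p))
    (r : compos n k) :
  [forall q, \sum_p part (s p) q == part r q]%N
  = ((\sum_p mono (s p))%MM == mono r).
Proof.
have E q : (\sum_p mono (s p))%MM q = (\sum_p part (s p) q)%N.
  by rewrite mnm_sumE; apply: eq_bigr => x _; rewrite mnmE.
apply/forallP/eqP => [h|h q]; last by rewrite -E h mnmE.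
by apply/mnmP => q; rewrite E mnmE; apply/eqP.
Qed.

Lemma i_mxE k (t : compos n k) f r :
  let s p : compos n (part t p) :=
    enum_val ((enum_val f : tidx (fun p => sdim n (part t p))) p) in
  let rho : compos n k := enum_val r in
  i_mx R t f r = if (\sum_p mono (s p))%MM == mono rho
                 then (multi R rho)^-1 * \prod_p multi R (s p) else 0.
Proof. by move=> s rho; rewrite mxE -family_mono. Qed.

(** A family of compositions has only one total, whence the zeros off the diagonal. On it, the
    factors [multi R (s p)] of the two entries of [i_mx] cancel the inverse squares in the middle
    matrix, and the sum over M(t, r) that remains is a coefficient of the product. *)
Lemma i_form k (t : compos n k) (P : 'I_n.+1 -> {mpoly R[i][n.+1]})
    (hP : forall p, P p \is (part t p).-homog) :
  (i_mx R t)^t*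
  *m tensmx (fun p => diag_mx (\row_s
       ((multi R (enum_val s : compos n (part t p)))^-2
        * (P p)@_(mono (enum_val s : compos n (part t p))))))
  *m i_mx R t
  = diag_mx (\row_r ((multi R (enum_val r : compos n k))^-2
                     * (\prod_p P p)@_(mono (enum_val r : compos n k)))).
Proof.
rewrite tensmx_diag; apply/matrixP => r r'; rewrite adjoint_diag_entry !mxE.
have [<-|nr] := eqVneq r r'; last first.
  rewrite mulr0n big1 // => f _; rewrite !i_mxE.
  case: eqP => e1; last by rewrite rmorph0 !mul0r.
  case: eqP => e2; last by rewrite mulr0.
  by case/eqP: nr; apply/enum_val_inj/mono_inj; rewrite -e1 -e2.
rewrite mulr1n.
(* Homogeneity lets the product be expanded over the very families that index the rows of [i_mx]. *)
have -> : \prod_p P p = \sum_(f : tidx (fun p => sdim n (part t p)))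
    (\prod_p (P p)@_(mono (enum_val (f p))))
    *: 'X_[(\sum_p mono (enum_val (f p)))%MM].
  rewrite -(eq_bigr _ (fun p _ => esym (homog_expansion (hP p)))).
  under eq_bigr => p _ do rewrite -sum_enum_val.
  rewrite (prod_sum_dffun (T := fun p => 'I_(sdim n (part t p)))).
  by apply: eq_bigr => f _; rewrite scaler_prod mprodXE.
rewrite raddf_sum /= mulr_sumr -[RHS]sum_enum_val.
apply: eq_bigr => f _; rewrite !i_mxE mxE mcoeffZ mcoeffX.
case: eqP => e; last by rewrite !mulr0.
under [X in _ * X * _]eq_bigr => p _ do rewrite mxE.
rewrite mulr1 rmorphM fmorphV rmorph_prod /= conj_multi.
under [X in _ * X * _ * _]eq_bigr => p _ do rewrite conj_multi.
rewrite [X in _ * X * _]big_split /= [X in _ * (X * _) * _]prodfV [X in _ * (X^-1 * _) * _]prodrXl.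
set z := \prod_i multi R _; have nz : z != 0.
  by apply/prodf_neq0 => p _; exact: multi_neq0.
have nr := multi_neq0 R (enum_val r : compos n k).
by field; rewrite nz nr.
Qed.

End Embeddings.

(** * Compression of the torus action along [beta] *)

Section DiagonalTorus.

Variables (R : realType) (n : nat).
Implicit Types (a : Gelt R n) (W : hrep R (Gelt R n)).

Lemma inAreg_inA a : inAreg a -> inA a.
Proof. by case=> t [ht -> _]; exists t. Qed.

Lemma inA_inG a : inA a -> inG a.
Proof. by case=> t [ht ->]; split; rewrite /inSL /= ?det_inv det_diag ht ?invr1. Qed.

Lemma inSU_diag (d : 'rV[R[i]]_n.+1) :
  \prod_i d 0 i = 1 -> (forall i, Num.conj (d 0 i) * d 0 i = 1) ->
  inSU (diag_mx d).
Proof.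
move=> hd hu; split; first by rewrite /inSL det_diag.
apply/matrixP => i j; rewrite mul_mx_diag !mxE.
have [_|_] := eqVneq i j; first by rewrite !mulr1n hu.
by rewrite !mulr0n rmorph0 mul0r.
Qed.

(* (diag d, diag d) lies in U and centralises A. *)
Lemma compression_diag_conj W (beta : 'M[R[i]]_(rdim W, rdim (stdrep R n))) a
    (d : 'rV[R[i]]_n.+1) :
  is_Gmodule W -> isoHembedding beta -> inA a -> inSU (diag_mx d) ->
  (diag_mx d)^t* *m (beta^t* *m rform W *m ract W a *m beta) *m diag_mx d
  = beta^t* *m rform W *m ract W a *m beta.
Proof.
case=> _ Wmul _ _ Winv [_ bH] Aa hd.
have aG := inA_inG Aa.
have uG : inG (diag_mx d, diag_mx d) by case: hd.
have ba := bH _ hd.1; rewrite /= in ba.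
have comm : ract W a *m ract W (diag_mx d, diag_mx d)
            = ract W (diag_mx d, diag_mx d) *m ract W a.
  rewrite -!Wmul //; congr (ract W _); case: Aa => t [ht ->].
  rewrite /Gmul /torus_elt /=; congr (_, _).
    by rewrite !mulmx_diag; congr diag_mx; apply/rowP => i; rewrite !mxE mulrC.
  have ut : diag_mx t \in unitmx by rewrite unitmxE det_diag ht unitr1.
  rewrite -[LHS]mulmx1 -(mulmxV ut) mulmxA -(mulmxA _ (diag_mx d)).
  rewrite [diag_mx d *m diag_mx t]mulmx_diag.
  have -> : (\row_j (d 0 j * t 0 j)) = \row_j (t 0 j * d 0 j) :> 'rV_n.+1.
    by apply/rowP => i; rewrite !mxE mulrC.
  by rewrite -mulmx_diag mulmxA mulVmx // mul1mx.
have uinv := Winv (diag_mx d, diag_mx d) (conj hd hd).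
transitivity ((beta *m diag_mx d)^t* *m rform W *m ract W a
              *m (beta *m diag_mx d)); first by rewrite adjointM !mulmxA.
(* Equivariance carries [diag_mx d] through [beta], commutation carries it past [a], and invariance
   of the form under U absorbs it. *)
rewrite ba adjointM !mulmxA -(mulmxA _ (ract W a)) comm.
transitivity (beta^t* *m ((ract W (diag_mx d, diag_mx d))^t* *m rform W
              *m ract W (diag_mx d, diag_mx d)) *m ract W a *m beta).
  by rewrite !mulmxA.
by rewrite uinv.
Qed.

(** Conjugation by [diag_mx d] multiplies the entry (i, j) by conj(d_i) d_j, so a [d] for which this
    factor is -1 forces the entry to vanish. *)
Lemma compression_diag W (beta : 'M[R[i]]_(rdim W, rdim (stdrep R n))) a :
  is_Gmodule W -> isoHembedding beta -> inA a ->
  let F := beta^t* *m rform W *m ract W a *m beta in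
  F = diag_mx (\row_i F i i).
Proof.
move=> hW hb Aa F; apply/matrixP => i j; rewrite !mxE.
have [->|nij] := eqVneq i j; first by rewrite mulr1n.
rewrite mulr0n.
(* The entries at [i] and [j] are the imaginary unit and its opposite: their product is 1, so the
   determinant is 1 even when there is no third coordinate, and conj(d_i) d_j = -1. *)
pose d : 'rV[R[i]]_n.+1 :=
  \row_l if l == i then Num.imaginary else if l == j then - Num.imaginary else 1.
have iiN : Num.imaginary * Num.imaginary = -1 :> R[i] by rewrite -expr2 sqrCi.
have hd : inSU (diag_mx d).
  apply: inSU_diag => [|l]; rewrite ?mxE.
    rewrite (bigD1 i) //= (bigD1 j) 1?eq_sym //= !mxE eqxx eq_sym (negbTE nij).
    rewrite eqxx mulrA mulrN iiN opprK mul1r big1 // => l /andP[nli nlj].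
    by rewrite mxE (negbTE nli) (negbTE nlj).
  case: ifP => _; first by rewrite conjCi mulNr iiN opprK.
  by case: ifP => _; rewrite ?rmorphN ?rmorph1 ?mulr1 //= conjCi opprK mulrN iiN opprK.
have /matrixP/(_ i j) := compression_diag_conj hW hb Aa hd; rewrite -/F.
rewrite mul_mx_diag mxE.
have -> : (diag_mx d)^t* = diag_mx (map_mx Num.conj d).
  by rewrite tr_diag_mx map_diag_mx.
rewrite mul_diag_mx !mxE eqxx eq_sym (negbTE nij) eqxx /= conjCi.
set x := \sum_j0 _; rewrite mulrN mulrAC mulNr iiN opprK mul1r => /eqP.
by rewrite eq_sym -addr_eq0 -mulr2n mulrn_eq0 /= => /eqP.
Qed.

(** The Gram matrix of [stdrep] is the identity, so [adj beta] is [beta^t* *m rform W]. For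
    [l = lam p] the diagonal is column [p] of [ga]. *)
Lemma spherical_std (PhiV : Gweight n -> Gelt R n -> 'M[R[i]]_(rdim (stdrep R n)))
    l W (beta : 'M[R[i]]_(rdim W, rdim (stdrep R n))) a :
  is_spherical l (PhiV l) -> is_VG l W -> isoHembedding beta -> inA a ->
  beta^t* *m rform W *m ract W a *m beta = diag_mx (\row_i PhiV l a i i).
Proof.
move=> hPhi hW hb Aa.
have -> : PhiV l a = beta^t* *m rform W *m ract W a *m beta.
  by rewrite (hPhi W hW beta hb a (inA_inG Aa)) /adj /= invmx1 mul1mx.
by case: hW => hW _ _; exact: compression_diag.
Qed.

End DiagonalTorus.

(** * Compression along the whole embedding [gamma] *)

Lemma invmx_diag (F : fieldType) m (d : 'rV[F]_m) :
  (forall i, d 0 i != 0) -> invmx (diag_mx d) = diag_mx (\row_i (d 0 i)^-1).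
Proof.
move=> nz; set e := \row_i _.
have de : diag_mx d *m diag_mx e = 1%:M.
  by rewrite mulmx_diag -diag_const_mx; congr diag_mx; apply/rowP => i; rewrite !mxE divff.
by rewrite -[RHS]mul1mx -(mulVmx (mulmx1_unit de).1) -mulmxA de mulmx1.
Qed.

Lemma gamma_compression (R : realType) (n k : nat)
    (PhiV : Gweight n -> Gelt R n -> 'M[R[i]]_(rdim (stdrep R n)))
    (hPhiV : forall l : Gweight n, is_spherical l (PhiV l))
    (W : 'I_n.+1 -> hrep R (Gelt R n))
    (hW : forall p : 'I_n.+1, is_VG (lam p) (W p))
    (beta : forall p : 'I_n.+1, 'M[R[i]]_(rdim (W p), rdim (stdrep R n)))
    (hbeta : forall p : 'I_n.+1, isoHembedding (beta p))
    (a : Gelt R n) (Aa : inA a) (t : compos n k) (s : 'I_(sdim n k)) :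
  (adj (gamma beta t) *m ract (Trep W t) a *m gamma beta t) s s
  = (multi R (enum_val s : compos n k))^-1
    * symmx k (ga PhiV a) s (enum_rank t).
Proof.
pose c p : 'rV[R[i]]_n.+1 := \row_j ga PhiV a j p.
have cE p : c p = \row_j PhiV (lam p) a j j by apply/rowP => j; rewrite !mxE.
pose P p := linform (c p) ^+ part t p.
have hP p : P p \is (part t p).-homog.
  by have := dhomogMn (part t p) (linform_homog (c p)); rewrite mul1n.
have core : (gamma beta t)^t* *m rform (Trep W t) *m ract (Trep W t) a
      *m gamma beta t
    = diag_mx (\row_r ((multi R (enum_val r : compos n k))^-2
                     * (\prod_p P p)@_(mono (enum_val r : compos n k)))).
  (* The layers are peeled off from the outside: [i_mx], then [as_mx] in each factor, then [beta p]
     in each tensor position. *)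
  rewrite -(i_form hP) /gamma adjointM -!mulmxA; congr (_ *m _).
  rewrite !mulmxA; congr (_ *m _); rewrite /= tensmx_form.
  apply: eq_tensmx => p; rewrite -as_form adjointM -!mulmxA; congr (_ *m _).
  rewrite !mulmxA; congr (_ *m _); rewrite tensmx_form.
  by apply: eq_tensmx => _; rewrite cE; exact: spherical_std.
rewrite /adj -!mulmxA [_ *m (rform _ *m _)]mulmxA [_ *m (ract _ _ *m _)]mulmxA.
rewrite [X in invmx _ *m X](_ : _ = (gamma beta t)^t* *m rform (Trep W t) *m ract (Trep W t) a
      *m gamma beta t); last by rewrite !mulmxA.
(* The inverse Gram matrix of [symrep] supplies one factor [multi], which turns the inverse square
   into an inverse. *)
rewrite core /= invmx_diag => [|i]; last by rewrite mxE invr_eq0 multi_neq0.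
rewrite symmxE mul_diag_mx !mxE eqxx mulr1n enum_rankK invrK.
by rewrite mulrA; congr (_ * _); rewrite expr2 invfM mulrA divff ?mul1r ?multi_neq0.
Qed.

(** * The weights lambda(0, t) are pairwise distinct *)

Lemma lam_coord n (i : 'I_n.+1) (j : 'I_n) : (lam i).1 j = (j == i :> nat)%:Z.
Proof. by rewrite ffunE eqSS. Qed.

Lemma lam0_coord n k (t : compos n k) (j : 'I_n) :
  (lam0 t).1 j = (part t (widen_ord (leqnSn n) j))%:Z.
Proof.
rewrite /lam0 (raddf_sum fst) /= sum_ffunE (bigD1 (widen_ord (leqnSn n) j)) //=.
rewrite big1 ?addr0 => [|i nij].
  by rewrite (raddfMn fst) ffunMnE lam_coord eqxx /= -[RHS]natz.
rewrite (raddfMn fst) ffunMnE lam_coord.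
case: eqP => [e|_]; last by rewrite mul0rn.
by case/eqP: nij; apply/val_inj.
Qed.

(** The first component of the weight shows every part except the last, because omega_(n+1) = 0; the
    last part is recovered from the total [k]. *)
Lemma lam0_inj n k : injective (@lam0 n k).
Proof.
move=> s t e.
have es (j : 'I_n) : part s (widen_ord (leqnSn n) j) = part t (widen_ord (leqnSn n) j).
  by have := congr1 (fun l : Gweight n => l.1 j) e; rewrite !lam0_coord => -[].
apply/val_inj/ffunP => i; apply/val_inj; rewrite -/(part s i) -/(part t i).
have := etrans (sum_part s) (esym (sum_part t)).
rewrite !big_ord_recr /= (eq_bigr _ (fun j _ => es j)) => /addnI emax.
case: (unliftP ord_max i) => [j ->|->] //.
have -> : lift ord_max j = widen_ord (leqnSn n) j.
  by apply/val_inj; rewrite /= /bump leqNgt ltn_ord.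
exact: es.
Qed.

Theorem theorem6p7 (R : realType) (n k : nat) (hn : (1 <= n)%N)
    (PhiV : Gweight n -> Gelt R n -> 'M[R[i]]_(rdim (stdrep R n)))
    (hPhiV : forall l : Gweight n, is_spherical l (PhiV l))
    (Phi : Gweight n -> Gelt R n -> 'M[R[i]]_(rdim (symrep R n k)))
    (hPhi : forall l : Gweight n, is_spherical l (Phi l))
    (W : 'I_n.+1 -> hrep R (Gelt R n))
    (hW : forall p : 'I_n.+1, is_VG (lam p) (W p))
    (beta : forall p : 'I_n.+1, 'M[R[i]]_(rdim (W p), rdim (stdrep R n)))
    (hbeta : forall p : 'I_n.+1, isoHembedding (beta p))
    (CGamma : 'M[R[i]]_(sdim n k))
    (hC : is_CGamma Phi beta CGamma)
    (a : Gelt R n) (ha : inAreg a) :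
  Phi0 Phi a *m CGamma
  = Dmx R n k *m symmx_normalized k (ga PhiV a) *m Dmx R n k.
Proof.
have Aa := inAreg_inA ha.
apply/matrixP => s t'; rewrite -(enum_valK t'); set t := enum_val t'.
have [w [c [[uw ws] c0 hc hCt]]] := hC t.
have mspos r : sqrtC (multi R (r : compos n k)) != 0.
  by rewrite sqrtC_eq0 multi_neq0.
transitivity ((multi R (enum_val s : compos n k))^-1
              * symmx k (ga PhiV a) s (enum_rank t)).
  rewrite -(gamma_compression hPhiV hW hbeta Aa) hc // summxE mxE.
  under [RHS]eq_bigr do rewrite mxE.
  (* Weights not of the form lambda(0, r) have coefficient zero. *)
  rewrite [RHS](bigID (fun l => l \in codom (@lam0 n k))) /=.
  rewrite [X in _ = _ + X]big1 ?addr0 => [|l nl]; last first.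
    have [->|/c0[_ [r el]]] := eqVneq (c l) 0; first by rewrite mul0r.
    by rewrite el codom_f in nl.
  under eq_bigr => r _.
    rewrite mxE -[r in CGamma r _]enum_valK hCt; over.
  rewrite (sum_enum_val (fun r : compos n k => Phi (lam0 r) a s s * c (lam0 r))).
  (* The sum over compositions becomes a sum over distinct weights; those outside [w] drop out since
     [c] is zero there, and the two lists then agree up to order. *)
  transitivity (\sum_(l <- map (@lam0 n k) (enum (compos n k))) c l * Phi l a s s).
    by rewrite big_map big_enum /=; apply: eq_bigr => r _; rewrite mulrC.
  rewrite (bigID (fun l => l \in w)) /= [X in _ + X]big1 ?addr0 => [|l nl]; last first.
    by have [->|/c0[wl _]] := eqVneq (c l) 0; [rewrite mul0r | rewrite wl in nl].
  rewrite -[LHS]big_filter -[RHS]big_filter; apply: perm_big; apply: uniq_perm.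
  - by rewrite filter_uniq // map_inj_uniq ?enum_uniq //; exact: lam0_inj.
  - by rewrite filter_uniq.
  - by move=> l; rewrite !mem_filter andbC.
(* The left [Dmx] and the inverse of the normalized basis multiply to [multi] inverse at [s]; on the
   right the normalized basis and [Dmx] cancel. *)
rewrite /symmx_normalized /Dmx /normalized_basis invmx_diag => [|i]; last by rewrite mxE.
rewrite !mul_mx_diag !mul_diag_mx !mxE !rootCV ?multi_ge0 //.
rewrite -[multi R (enum_val s) in LHS]sqrtCK expr2 invfM.
by rewrite -!mulrA; congr (_ * (_ * _)); rewrite enum_rankK divff ?mulr1.
Qed.
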